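(* Let $\beta>1$ be a real number. If the beta-shift $S_\beta$ is not sofic, then $S_\beta$ is topologically direct prime.
   Context: Notation: $\mathbb{N}=\{0,1,2,\dots\}$. The shift map on $A^{\mathbb{Z}}$ is $\sigma(x)[i]=x[i+1]$. A subshift is a nonempty closed set $X\subseteq A^{\mathbb{Z}}$ ($A$ finite) with $\sigma(X)=X$; $L(X)$ is the set of finite words occurring in elements of $X$. Two subshifts are (topologically) conjugate if there is a homeomorphism between them commuting with the shift maps. A product $X_1\times\cdots\times X_n$ of subshifts is regarded as a subshift over the product alphabet, with the coordinatewise shift. Beta-shifts: for real $\beta>1$ let $T_\beta:[0,1]\to[0,1]$, $T_\beta(\xi)=\beta\xi-\lfloor\beta\xi\rfloor$, and let $d(\beta)=d_0d_1d_2\cdots$ be the sequence with $d_i=\lfloor\beta\, T_\beta^{i}(1)\rfloor$ for $i\in\mathbb{N}$. Let $Y_\beta=\{d_0d_1\cdots d_{n-1}b\mid n\in\mathbb{N},\ b\in\mathbb{N},\ 0\le b<d_n\}$. The beta-shift $S_\beta\subseteq\{0,1,\dots,\lfloor\beta\rfloor\}^{\mathbb{Z}}$ is the subshift whose language $L(S_\beta)$ is the set of all subwords of finite concatenations of elements of $Y_\beta$. Direct primeness: a direct topological factorization of a subshift $X$ is a product $X_1\times\cdots\times X_n$ of subshifts which is conjugate to $X$. The subshift $X$ is topologically direct prime if it has no non-trivial direct factorization, i.e. if in every direct topological factorization $X_1\times\cdots\times X_n$ of $X$ one of the $X_i$ is a copy of $X$ (conjugate to $X$) and every other $X_i$ contains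 just one point. *)

(* Defs.v *)
From HB Require Import structures.
From mathcomp Require Import all_boot all_order all_algebra.
From mathcomp Require Import all_classical all_reals all_analysis.
From mathcomp Require Import zify.

Set Implicit Arguments.
Unset Strict Implicit.
Unset Printing Implicit Defensive.

Import Order.TTheory GRing.Theory Num.Theory.
Local Open Scope classical_set_scope.
Local Open Scope ring_scope.

(* The full shift A^Z with the product of the discrete topologies. *)
Definition config (A : finType) : topologicalType :=
  prod_topology (fun _ : int => discrete_topology A).

Definition shift (A : finType) (x : config A) : config A := fun i => x (i + 1).

Definition is_subshift (A : finType) (X : set (config A)) : Prop :=
  [/\ X !=set0, closed X & @shift A @` X = X].

(* block x i n is the word x[i] x[i+1] ... x[i+n-1]. *)
Definition block (A : finType) (x : config A) (i : int) (n : nat) : seq A :=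
  mkseq (fun k : nat => (x (i + k%:Z) : A)) n.

Definition language (A : finType) (X : set (config A)) : set (seq A) :=
  [set w | exists (x : config A) (i : int) (n : nat), X x /\ w = block x i n].

(* X and Y carry the subspace topologies; f and g only matter on X and Y. *)
Definition conjugate (A B : finType) (X : set (config A)) (Y : set (config B)) :
    Prop :=
  exists (f : config A -> config B) (g : config B -> config A),
    [/\ forall x, X x -> Y (f x) /\ g (f x) = x,
        forall y, Y y -> X (g y) /\ f (g y) = y,
        {within X, continuous f},
        {within Y, continuous g}
      & forall x, X x -> f (shift x) = shift (f x)].

(* Sofic in the sense of Lind and Marcus: X is the set of label sequences of
   the bi-infinite paths of a finite directed labeled graph with vertex set V
   and edge set E. *)
Definition sofic (A : finType) (X : set (config A)) : Prop :=
  exists (V E : finType) (src tgt : E -> V) (lab : E -> A),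
    X = [set x | exists p : int -> E,
           forall i, tgt (p i) = src (p (i + 1)) /\ x i = lab (p i)].

(* A configuration over the product alphabet belongs to the product when each
   of its coordinate sequences belongs to the corresponding factor. *)
Definition product_shift (n : nat) (B : 'I_n -> finType)
    (Y : forall i, set (config (B i))) :
    set (config {dffun forall i : 'I_n, B i}) :=
  [set x | forall i, Y i (fun k : int => (x k : {dffun forall i : 'I_n, B i}) i)].

(* Factorizations have at least one factor, hence the index type 'I_n.+1. *)
Definition direct_prime (A : finType) (X : set (config A)) : Prop :=
  forall (n : nat) (B : 'I_n.+1 -> finType) (Y : forall i, set (config (B i))),
    (forall i, is_subshift (Y i)) ->
    conjugate X (product_shift Y) ->
    exists i, conjugate X (Y i) /\
      forall j, j != i -> exists y, Y j = [set y].

Section BetaShift.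
Variables (R : realType) (beta : R).

Definition beta_map (xi : R) : R := beta * xi - (Num.floor (beta * xi))%:~R.

(* Num.truncn is the nat-valued floor; its arguments here are nonnegative. *)
Definition beta_digit (i : nat) : nat :=
  Num.truncn (beta * iter i beta_map 1).

Definition beta_code : set (seq nat) :=
  [set u | exists n b : nat,
     (b < beta_digit n)%N /\ u = rcons (mkseq beta_digit n) b].

Definition beta_language : set (seq nat) :=
  [set w | exists us : seq (seq nat),
     (forall u, u \in us -> beta_code u) /\ infix w (flatten us)].

(* The subshift with language beta_language; see beta_shift_subshift and
   language_beta_shift below. *)
Definition beta_shift : set (config 'I_(Num.truncn beta).+1) :=
  [set x | forall i n, beta_language (map val (block x i n))].

End BetaShift.

Arguments beta_shift {R} beta _.

Lemma closed_blocks (A : finType) (P : seq A -> Prop) :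
  closed [set x : config A | forall i n, P (block x i n)].
Proof.
move=> x clx i n.
have nb : nbhs x [set y : config A | block y i n = block x i n].
  rewrite /block; elim: n => [|n IH]; first by apply: filterS filterT => y _.
  have nbn : nbhs x [set y : config A | y (i + n%:Z) = x (i + n%:Z)].
    have /(_ [set x (i + n%:Z)]) := @proj_continuous int
      (fun _ => discrete_topology A : topologicalType) (i + n%:Z) x.
    by apply; exact: discrete_set1.
  apply: filterS (filterI IH nbn) => y /= [e1 e2].
  by rewrite !mkseqS e1; congr rcons.
by have [y [/= Py <-]] := clx _ nb.
Qed.

Lemma beta_map_itv (R : realType) (beta xi : R) :
  0 <= beta_map beta xi <= 1.
Proof.
rewrite /beta_map; have := Num.Theory.floor_le (beta * xi).
have := Num.Theory.floorD1_gt (beta * xi); rewrite intrD => h1 h2.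
by rewrite subr_ge0 h2 lerBlDl ltW.
Qed.

Lemma beta_digit_le (R : realType) (beta : R) (i : nat) :
  1 < beta -> (beta_digit beta i <= Num.truncn beta)%N.
Proof.
move=> b1; apply: le_truncn; have b0 : 0 <= beta by apply: ltW; apply: lt_trans b1.
case: i => [|i] /=; first by rewrite mulr1.
by have /andP[_ h] := beta_map_itv beta (iter i (beta_map beta) 1); exact: ler_piMr.
Qed.

Lemma beta_language_infix (R : realType) (beta : R) (v w : seq nat) :
  infix v w -> beta_language beta w -> beta_language beta v.
Proof. by move=> vw [us [hus h]]; exists us; split=> //; exact: infix_trans h. Qed.

Lemma beta_language_bounded (R : realType) (beta : R) (w : seq nat) (a : nat) :
  1 < beta -> beta_language beta w -> a \in w -> (a <= Num.truncn beta)%N.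
Proof.
move=> b1 [us [hus iw]] /(mem_infix iw) /flattenP[u /hus [n [b [bn ->]]]].
rewrite mem_rcons inE => /orP[/eqP ->|/mapP[k _ ->]].
  exact: leq_trans (ltnW bn) (beta_digit_le _ b1).
exact: beta_digit_le.
Qed.

(* A word of beta_language extends by zeros on both sides. *)
Lemma beta_language_extend (R : realType) (beta : R) (w : seq nat) :
  1 < beta -> beta_language beta w ->
  exists (x : config 'I_(Num.truncn beta).+1) (i : int),
    beta_shift beta x /\ w = map val (block x i (size w)).
Proof.
move=> b1 [us [hus /infixP[p [s us_eq]]]]; set u := flatten us in us_eq.
have code0 : beta_code beta [:: 0%N].
  by exists 0%N, 0%N; split=> //; rewrite /beta_digit /= mulr1 truncn_gt0 ltW.
have fl0 k : flatten (nseq k [:: 0%N]) = nseq k 0%N.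
  by elim: k => //= k ->.
have pad a b : beta_language beta (nseq a 0%N ++ u ++ nseq b 0%N).
  exists (nseq a [:: 0%N] ++ us ++ nseq b [:: 0%N]); split.
    move=> v; rewrite !mem_cat !mem_nseq.
    by move=> /or3P[/andP[_ /eqP ->]|/hus|/andP[_ /eqP ->]].
  by rewrite !flatten_cat !fl0 infix_refl.
pose z (i : int) : nat := if i is Posz k then nth 0%N u k else 0%N.
have z_le i : (z i < (Num.truncn beta).+1)%N.
  rewrite ltnS; case: i => [k|k] //=.
  have [ku|ku] := ltnP k (size u); last by rewrite nth_default.
  have lu : beta_language beta u by have := pad 0%N 0%N; rewrite /= cats0.
  exact: beta_language_bounded b1 lu (mem_nth _ ku).
pose x : config 'I_(Num.truncn beta).+1 := fun i => Ordinal (z_le i).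
have xE i n : map val (block x i n) = mkseq (fun k => z (i + k%:Z)) n.
  by rewrite /block /mkseq -map_comp.
exists x, (size p)%:Z; split.
  move=> i n /=; rewrite xE.
  pose a := `|i|%N; pose v := nseq a 0%N ++ u ++ nseq (a + n) 0%N.
  apply: (beta_language_infix _ (pad a (a + n)%N)); rewrite -/v.
  pose c := `|(i + a%:Z)%R|%N.
  have -> : mkseq (fun k => z (i + k%:Z)) n = take n (drop c v).
    have sz : (n <= size (drop c v))%N.
      rewrite size_drop /v !size_cat !size_nseq /c; lia.
    apply: (@eq_from_nth _ 0%N); first by rewrite size_mkseq size_takel.
    move=> k; rewrite size_mkseq => kn.
    rewrite nth_mkseq // nth_take // nth_drop /v nth_cat size_nseq nth_nseq.
    case E : (i + k%:Z) => [j|j].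
      have -> : (c + k < a)%N = false by rewrite /c; lia.
      have -> : (c + k - a = j)%N by rewrite /c; lia.
      rewrite nth_cat nth_nseq /=; case: ifP => // ju.
      by rewrite if_same nth_default // leqNgt ju.
    by have -> : (c + k < a)%N by rewrite /c; lia.
  exact: infix_trans (infix_take _ _) (infix_drop _ _).
apply: (@eq_from_nth _ 0%N); first by rewrite xE size_mkseq.
move=> k kw; rewrite xE nth_mkseq //= us_eq nth_cat.
by rewrite ltnNge leq_addr /= addKn nth_cat kw.
Qed.

Lemma beta_shift_subshift (R : realType) (beta : R) :
  1 < beta -> is_subshift (beta_shift beta).
Proof.
move=> b1; split.
- have : beta_language beta [::] by exists [::].
  by move/(beta_language_extend b1) => [x [i [hx _]]]; exists x.
- exact: (@closed_blocks _ (fun w => beta_language beta (map val w))).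
apply/seteqP; split=> [_ [x hx <-] i n|x hx].
  have -> : block (shift x) i n = block x (i + 1) n; last exact: hx.
  by apply: eq_mkseq => k; rewrite /shift; congr x; rewrite addrAC.
exists (fun i => x (i - 1)); last first.
  by apply: funext => i; rewrite /shift addrK.
move=> i n; have <- : block x (i - 1) n = block (fun i => x (i - 1)) i n.
  by apply: eq_mkseq => k; congr x; rewrite addrAC.
exact: hx.
Qed.

Lemma language_beta_shift (R : realType) (beta : R) :
  1 < beta -> map val @` language (beta_shift beta) = beta_language beta.
Proof.
move=> b1; apply/seteqP; split=> [_ [_ [x [i [n [hx ->]]]] <-]|w]; first exact: hx.
move/(beta_language_extend b1) => [x [i [hx e]]].
by exists (block x i (size w)) => //; exists x, i, (size w).
Qed.

(* Main.v *)
From mathcomp Require Import all_boot all_order all_algebra.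
From mathcomp Require Import all_classical all_reals all_analysis.
From mathcomp Require Import zify.
Require Import Defs.

Set Implicit Arguments.
Unset Strict Implicit.
Unset Printing Implicit Defensive.

Import Order.TTheory GRing.Theory Num.Theory.
Local Open Scope classical_set_scope.
Local Open Scope ring_scope.

(** Let d be the digit sequence of beta.  Since the expansion is greedy, every
tail of d is lexicographically at most d ([beta_digit_self_admissible]).  If d
is eventually periodic, the finitely many tails of d are the vertices of a
labeled graph that presents the beta-shift, which is then sofic
([periodic_sofic]).  Otherwise the beta-shift X consists of the sequences all
of whose right rays are lexicographically at most d ([beta_shiftE]).

Follower sets.  In X an admissible right ray may follow a left ray u exactly
when it lies below a tail of d, or a limit of tails of d, which u determines.
Follower sets are therefore totally ordered by inclusion
([admissible_nested]).  A conjugacy has a finite radius, so it preserves this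
nesting for left rays that share a long enough window ([nested_transfer]).
Call a position of a point critical when the left ray ending there does not
have the largest follower set among the left rays with the same last N letters.
If in a product of subshifts two different coordinates had critical positions,
exchanging the larger and the smaller follower sets in these two coordinates
would give incomparable follower sets.  So all critical positions in a product
conjugate to X come from one coordinate i ([critical_coordinate]), and i exists
because the point that is 0 on the left and d on the right is critical at all
late positions: the tails of d are pairwise distinct
([digit_ray_critical]).

Rigidity.  Take the image w of that point in the product and replace a
coordinate j other than i by a periodic point z of the factor j.  Coordinate i
still makes all late positions critical, so the preimage in X of the new point
is critical at all late positions, and its left ray is periodic.  Such a point
of X ends with a tail of d ([critical_tail]): late left rays always match
nonempty prefixes of d, and when a longest match is broken no nonempty match
survives.  Applying the conjugacy again, z agrees far to the right with a
translate of coordinate j of w.  This holds for every periodic z, among them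
the constant point that comes from the zero sequence, so the factor j has only
one periodic point.  Periodic points are dense in X
([periodic_approximation]), hence in the factor j, which is a single point
([other_coordinate_singleton]).  With all other factors trivial, the projection
to coordinate i is a conjugacy. *)

(** * Block maps and cylinders *)

Definition cylinder (A : finType) (x : config A) (n : nat) : set (config A) :=
  [set y | forall k : int, - n%:Z <= k <= n%:Z -> y k = x k].

Lemma cylinder_nbhs (A : finType) (x : config A) (n : nat) :
  nbhs x (cylinder x n).
Proof.
have nbk (k : int) : nbhs x [set y : config A | y k = x k].
  have /(_ [set x k]) := @proj_continuous int
    (fun _ => discrete_topology A : topologicalType) k x.
  by apply; exact: discrete_set1.
elim: n => [|n IH].
  by apply: filterS (nbk 0) => y /= y0 k k0; have -> : k = 0 by lia.
apply: filterS (filterI IH (filterI (nbk n.+1%:Z) (nbk (- n.+1%:Z)))).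
move=> y /= [yn [y1 y2]] k kn.
have [->//|k1] := eqVneq k n.+1%:Z.
have [->//|k2] := eqVneq k (- n.+1%:Z).
by apply: yn; lia.
Qed.

Lemma compact_config (A : finType) : compact [set: config A].
Proof.
have := @tychonoff int (fun _ => discrete_topology A : topologicalType)
  (fun _ => setT).
rewrite (_ : [set f | _] = setT); last by apply/seteqP; split.
by apply=> i; apply: finite_compact; exact: (@finite_finset A setT).
Qed.

(** The complement of the interior of U is compact and each of its points
leaves some cylinder at x together with a neighbourhood, so one cylinder avoids
it altogether. *)
Lemma nbhs_cylinder (A : finType) (x : config A) (U : set (config A)) :
  nbhs x U -> exists n, cylinder x n `<=` U.
Proof.
move=> xU; pose K := ~` U°.
have cK : compact K.
  apply: (@subclosed_compact _ _ setT) => //; last exact: compact_config.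
  by apply: open_closedC; exact: open_interior.
have /(_ nat \oo (fun n y => ~ cylinder x n y)) : near_covering K.
  exact/compact_near_coveringP.
case.
  move=> y Ky; have [k yk] : exists k, y k <> x k.
    apply: contrapT => /forallNP h; apply: Ky.
    suff -> : y = x by [].
    by apply: funext => k; apply: contrapT => /(h k).
  exists (cylinder y `|k|%N, [set n | (`|k| <= n)%N]).
    by split; [exact: cylinder_nbhs|exists `|k|%N].
  move=> [z n] /= [zy kn] zx; apply: yk.
  by rewrite -zy -?zx //; lia.
move=> n _ /(_ n (leqnn n)) h; exists n => y yx.
by apply: contrapT => nUy; apply: (h y _ yx) => /interior_subset.
Qed.

(** Cylinders form neighbourhood bases on both sides, and a cylinder of the
target constrains finitely many coordinates, so their windows have a common
bound. *)
Lemma within_continuous_configP (A B : finType) (X : set (config A))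
    (f : config A -> config B) :
  {within X, continuous f} <->
  (forall x, X x -> forall k, exists n,
     forall y, X y -> cylinder x n y -> f y k = f x k).
Proof.
rewrite subspace_continuousP; split=> [cf x Xx k|cf x Xx V].
  have /cf : nbhs (f x) [set z | z k = f x k].
    by apply: filterS (cylinder_nbhs (f x) `|k|%N) => z; apply; lia.
  move=> /(_ Xx); rewrite /= /within /= => /nbhs_cylinder[n hn].
  by exists n => y Xy /hn; apply.
move=> /nbhs_cylinder[m mV]; rewrite /= /within /=.
suff [n hn] : exists n, forall y, X y -> cylinder x n y ->
    cylinder (f x) m (f y).
  by apply: filterS (cylinder_nbhs x n) => y yx Xy; apply/mV/hn.
elim: m {mV} => [|m [n hn]].
  have [n hn] := cf x Xx 0; exists n => y Xy /(hn _ Xy) y0 k k0.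
  by have -> : k = 0 by lia.
have [n1 h1] := cf x Xx m.+1%:Z; have [n2 h2] := cf x Xx (- m.+1%:Z).
exists (n + n1 + n2)%N => y Xy yx k km.
have yx' n' : (n' <= n + n1 + n2)%N -> cylinder x n' y.
  by move=> le_n l ln; apply: yx; lia.
have [->|k1] := eqVneq k m.+1%:Z; first by apply: h1 => //; apply: yx'; lia.
have [->|k2] := eqVneq k (- m.+1%:Z); first by apply: h2 => //; apply: yx'; lia.
by apply: (hn y Xy); [apply: yx'; lia|lia].
Qed.

Definition translate (A : finType) (a : int) (x : config A) : config A :=
  fun i => x (i + a).

Lemma translate_ind (A : finType) (P : int -> config A -> Prop) (x : config A) :
  P 0 x ->
  (forall a y, P a y -> P (a + 1) (shift y) /\
     P (a - 1) (translate (- 1) y)) ->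
  forall a, P a (translate a x).
Proof.
move=> P0 PS; have Pn n : P n%:Z (translate n%:Z x).
  elim: n => [|n /PS[+ _]].
    rewrite (_ : translate _ x = x) //.
    by apply: funext => i; rewrite /translate addr0.
  rewrite -[n.+1]addn1 PoszD (_ : shift _ = translate (n%:Z + 1) x) //.
  by apply: funext => i; rewrite /translate /shift -addrA [1 + _]addrC.
have PN n : P (- n%:Z) (translate (- n%:Z) x).
  elim: n => [|n /PS[_]]; first by rewrite oppr0; exact: Pn 0%N.
  rewrite -[n.+1]addn1 PoszD opprD.
  rewrite (_ : translate _ _ = translate (- n%:Z - 1) x) //.
  by apply: funext => i; rewrite /translate -addrA [-1 + _]addrC.
by case=> n; [exact: Pn|rewrite NegzE; exact: PN].
Qed.

Definition shift_invariant (A : finType) (X : set (config A)) :=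
  forall a x, X x -> X (translate a x).

Lemma subshift_invariant (A : finType) (X : set (config A)) :
  @shift A @` X = X -> shift_invariant X.
Proof.
move=> sX a x Xx; apply: (@translate_ind A (fun _ => X)) => // b y Xy.
split; first by rewrite -sX; exists y.
move: Xy; rewrite -{1}sX => -[z Xz <-].
rewrite (_ : translate _ _ = z) //.
by apply: funext => i; rewrite /translate /shift subrK.
Qed.

(** The sliding block codes of radius r.  Comparing two positions a and b, and
not only two points at one position, makes commutation with the shift part of
the definition. *)
Definition local_rule (r : nat) (A B : finType) (X : set (config A))
    (f : config A -> config B) :=
  forall x y (a b : int), X x -> X y ->
    (forall l : int, - r%:Z <= l <= r%:Z -> x (a + l) = y (b + l)) ->
    f x a = f y b.

Lemma local_rule_leq r s (A B : finType) (X : set (config A))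
    (f : config A -> config B) :
  (r <= s)%N -> local_rule r X f -> local_rule s X f.
Proof. by move=> rs h x y a b Xx Xy e; apply: h => // l lr; apply: e; lia. Qed.

(** The Curtis-Hedlund-Lyndon theorem: by compactness one window serves all
points at position 0, and commutation with the shift carries it to every
position. *)
Lemma local_rule_of_continuous (A B : finType) (X : set (config A))
    (f : config A -> config B) :
  compact X -> shift_invariant X -> {within X, continuous f} ->
  (forall x, X x -> f (shift x) = shift (f x)) ->
  exists r, local_rule r X f.
Proof.
move=> cX iX /within_continuous_configP cf fs.
have ft a x : X x -> f (translate a x) = translate a (f x).
  move=> Xx.
  suff [] : X (translate a x) /\ f (translate a x) = translate a (f x) by [].
  apply: (@translate_ind A (fun a y => X y /\ f y = translate a (f x))).
    by split=> //; apply: funext => i; rewrite /translate addr0.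
  move=> b y [Xy fy]; split; split.
  - have -> : shift y = translate 1 y by [].
    exact: iX.
  - rewrite fs // fy; apply: funext => i.
    by rewrite /shift /translate -addrA [1 + b]addrC.
  - exact: iX.
  - apply: funext => i; have := fs _ (iX (-1) _ Xy).
    rewrite (_ : shift _ = y); last first.
      by apply: funext => j; rewrite /shift /translate addrK.
    rewrite fy => /(congr1 (fun z => z (i - 1))).
    by rewrite /translate /shift subrK => <-; congr (f x _); lia.
have /near_covering_withinP/(_ nat \oo (fun n x => forall y, X y ->
    cylinder x n y -> f y 0 = f x 0)) : near_covering X.
  exact/compact_near_coveringP.
case.
  move=> x Xx; have [n hn] := cf x Xx 0.
  exists (cylinder x n, [set m | (n <= m)%N]).
    by split; [exact: cylinder_nbhs|exists n].
  move=> [x' m] /= [x'x nm] Xx' y Xy yx'; rewrite (hn x') // (hn y) //.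
  by move=> k kn; rewrite yx' ?x'x //; lia.
move=> r _ /(_ r (leqnn r)) h; exists r => x y a b Xx Xy e.
have := h _ (iX a x Xx) _ (iX b y Xy); rewrite !ft // /translate !add0r.
by move=> -> // k kr; rewrite addrC -e // addrC.
Qed.

(** * Follower sets under conjugacy and in products *)

Definition glue (A : finType) (k : int) (u t : config A) : config A :=
  fun n => if n < k then u n else t n.

Definition agree (A : finType) (k : int) (N : nat) (u t : config A) :=
  forall n : int, k - N%:Z <= n < k -> u n = t n.

(** The follower sets of two left rays of points of X with a common window of
length N are comparable by inclusion: otherwise one takes for u and t points
whose right rays witness the two failures, and both gluings leave X. *)
Definition nested (A : finType) (N : nat) (X : set (config A)) :=
  forall k u t, X u -> X t -> agree k N u t -> X (glue k u t) \/ X (glue k t u).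

(** The left ray of u up to k does not have the largest follower set among
the left rays with the same last N letters. *)
Definition critical (A : finType) (N : nat) (X : set (config A))
    (u : config A) (k : int) :=
  exists t, [/\ X t, agree k N u t & ~ X (glue k u t)].

Lemma agree_sym (A : finType) k N (u t : config A) :
  agree k N u t -> agree k N t u.
Proof. by move=> h n /h. Qed.

Lemma agree_local (A B : finType) (X : set (config A))
    (f : config A -> config B) r k N (u t : config A) :
  local_rule r X f -> X u -> X t -> agree k N u t ->
  agree (k - r%:Z) (N - 2 * r) (f u) (f t).
Proof. by move=> lf Xu Xt e n kn; apply: lf => // l lr; apply: e; lia. Qed.

(** The cut moves to the left by r, so that the images before the cut do not
depend on the right ray; a common window of length 2r keeps the images after it
independent of the left ray of u. *)
Lemma local_glue (A B : finType) (X : set (config A))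
    (f : config A -> config B) r k (u t : config A) :
  local_rule r X f -> X u -> X t -> agree k (2 * r) u t -> X (glue k u t) ->
  f (glue k u t) = glue (k - r%:Z) (f u) (f t).
Proof.
move=> lf Xu Xt e Xg; apply: funext => n; rewrite {2}/glue.
case: ifPn => nk; apply: lf => // l lr; rewrite /glue; case: ifPn => // lk.
  by lia.
by apply: e; lia.
Qed.

Lemma glue_move (A : finType) k j N (u t : config A) :
  agree k N u t -> k - N%:Z <= j <= k -> glue j u t = glue k u t.
Proof.
move=> e jk; apply: funext => n; rewrite /glue.
by do 2!case: ifPn => //; move=> ? ?; [lia|rewrite -e //; lia].
Qed.

Section Transfer.
Variables (A B : finType) (X : set (config A)) (P : set (config B)).
Variables (f : config A -> config B) (g : config B -> config A) (r : nat).
Hypotheses (fP : forall x, X x -> P (f x)) (gX : forall y, P y -> X (g y)).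
Hypotheses (fK : forall y, P y -> f (g y) = y).
Hypotheses (gK : forall x, X x -> g (f x) = x).
Hypotheses (lf : local_rule r X f) (lg : local_rule r P g).

Lemma nested_transfer N : nested 0 X -> (4 * r <= N)%N -> nested N P.
Proof.
move=> nX rN k.
suff main p q : P p -> P q -> agree k N p q ->
    X (glue (k - r%:Z) (g p) (g q)) -> P (glue k p q).
  move=> p q Pp Pq e.
  have [||n|h|h] := nX (k - r%:Z) (g p) (g q); [exact: gX|exact: gX|lia|..].
    by left; exact: main.
  by right; apply: main => //; exact: agree_sym.
move=> Pp Pq e Xg; have e' := agree_local lg Pp Pq e.
have h : agree (k - r%:Z) (2 * r) (g p) (g q) by move=> n ?; apply: e'; lia.
have := fP Xg; rewrite (local_glue lf (gX Pp) (gX Pq) h Xg) !fK //.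
by rewrite (glue_move e) //; lia.
Qed.

Lemma critical_transfer N u k : X u -> (4 * r <= N)%N ->
  critical N X u k -> critical (N - 2 * r) P (f u) (k - r%:Z).
Proof.
move=> Xu rN [t [Xt e nXg]]; exists (f t).
(* A gluing of the images in P would be pulled back to the gluing of u and t. *)
have e' := agree_local lf Xu Xt e.
split; [exact: fP|exact: e'|move=> Pg; apply: nXg].
have h : agree (k - r%:Z) (2 * r) (f u) (f t) by move=> n ?; apply: e'; lia.
have := gX Pg; rewrite (local_glue lg (fP Xu) (fP Xt) h Pg) !gK //.
by rewrite (glue_move e) //; lia.
Qed.

End Transfer.

Lemma critical_translate (A : finType) N (X : set (config A)) u k a :
  shift_invariant X -> critical N X u k -> critical N X (translate a u) (k - a).
Proof.
move=> iX [t [Xt e nX]]; exists (translate a t); split; first exact: iX.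
  by move=> n nk; apply: e; lia.
move=> /(iX (- a)); rewrite (_ : translate _ _ = glue k u t) //.
apply: funext => n; rewrite /translate /glue subrK.
by rewrite (_ : (n - a < k - a) = (n < k)) //; lia.
Qed.

Section Product.
Variables (n : nat) (B : 'I_n -> finType) (Y : forall i, set (config (B i))).
Arguments Y : clear implicits.
Local Notation D := {dffun forall i : 'I_n, B i}.

Definition coord (i : 'I_n) (w : config D) : config (B i) :=
  fun k => (w k : D) i.

Definition update (i : 'I_n) (w : config D) (y : config (B i)) : config D :=
  fun k =>
    finfun (@eqtype.dfwith _ (fun j => B j) (fun j => (w k : D) j) i (y k)) : D.

Arguments update : clear implicits.

Lemma coord_ext (w v : config D) :
  (forall i, coord i w = coord i v) -> w = v.
Proof.
move=> h; apply: funext => k; apply/ffunP => i.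
by have := congr1 (fun z => z k) (h i).
Qed.

Lemma coord_update (i : 'I_n) (w : config D) (y : config (B i)) :
  coord i (update i w y) = y.
Proof. by apply: funext => k; rewrite /coord ffunE eqtype.dfwith_in. Qed.

Lemma coord_update_neq (i j : 'I_n) (w : config D) (y : config (B i)) :
  i != j -> coord j (update i w y) = coord j w.
Proof.
by move=> ij; apply: funext => k; rewrite /coord ffunE eqtype.dfwith_out.
Qed.

Lemma update_product i (w : config D) (y : config (B i)) :
  product_shift Y w -> Y i y -> product_shift Y (update i w y).
Proof.
move=> Pw Yy j; rewrite -/(coord j _).
have [ij|ij] := eqVneq i j; last by rewrite coord_update_neq //; exact: Pw.
by case: j / ij; rewrite coord_update.
Qed.

Lemma coord_glue i k (w v : config D) :
  coord i (glue k w v) = glue k (coord i w) (coord i v).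
Proof. by apply: funext => l; rewrite /coord /glue; case: ifP. Qed.

Lemma agree_coord k N (w v : config D) :
  (forall i, agree k N (coord i w) (coord i v)) -> agree k N w v.
Proof. by move=> h l lk; apply/ffunP => i; exact: h. Qed.

Lemma critical_product N w k :
  product_shift Y w -> critical N (product_shift Y) w k ->
  exists i, critical N (Y i) (coord i w) k.
Proof.
move=> Pw [t [Pt e nP]]; apply: contrapT => /forallNP h; apply: nP => i.
rewrite -/(coord i _) coord_glue; apply: contrapT => nY; apply: (h i).
exists (coord i t); split; [exact: Pt| |by []].
by move=> l /e wt; rewrite /coord wt.
Qed.

Lemma critical_update N i (w v : config D) k :
  product_shift Y v -> critical N (Y i) (coord i w) k ->
  coord i w = coord i v -> critical N (product_shift Y) v k.
Proof.
move=> Pv [t [Yt e nY]] wv; rewrite {}wv in e nY.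
exists (update i v t); split; first exact: update_product.
  apply: agree_coord => j; have [ij|ij] := eqVneq i j.
    by case: j / ij; rewrite coord_update.
  by rewrite coord_update_neq.
by move=> /(_ i); rewrite -/(coord i _) coord_glue coord_update.
Qed.

(** In coordinate i let y have a smaller follower set than y', in coordinate j
let z have a smaller one than z'.  The pairs (y, z') and (y', z) then have
incomparable follower sets. *)
Lemma nested_product_critical N w i j y z k :
  nested N (product_shift Y) -> product_shift Y w -> Y i y -> Y j z ->
  critical N (Y i) y k -> critical N (Y j) z k -> i = j.
Proof.
move=> nP Pw Yy Yz [y' [Yy' ey nY]] [z' [Yz' ez nZ]].
apply/eqP; apply: contrapT => /negP ij.
have ji : j != i by rewrite eq_sym.
pose p := update j (update i w y) z'; pose q := update j (update i w y') z.
have Pp : product_shift Y p by do 2!apply: update_product => //.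
have Pq : product_shift Y q by do 2!apply: update_product => //.
have pi : coord i p = y by rewrite coord_update_neq // coord_update.
have qi : coord i q = y' by rewrite coord_update_neq // coord_update.
have pj : coord j p = z' by rewrite coord_update.
have qj : coord j q = z by rewrite coord_update.
case: (nP k p q) => //.
- apply: agree_coord => l.
  have [jl|jl] := eqVneq j l.
    by case: l / jl; rewrite pj qj; exact: agree_sym.
  have [il|il] := eqVneq i l; first by case: l / il {jl}; rewrite pi qi.
  by rewrite !coord_update_neq.
- by move=> /(_ i); rewrite -/(coord i _) coord_glue pi qi.
- by move=> /(_ j); rewrite -/(coord j _) coord_glue pj qj.
Qed.

End Product.

Arguments update {n B} i w y.

(** * Sequences below a self-admissible digit sequence *)

(** Every tail of d is lexicographically at most d.  Here and in [admissible],
the lexicographic inequality is expressed without an order on sequences: at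
the end of each common prefix the next digit does not exceed that of d. *)
Definition self_admissible (d : nat -> nat) :=
  forall j n, (forall l, (l < n)%N -> d (j + l)%N = d l) ->
    (d (j + n)%N <= d n)%N.

Definition eventually_periodic (d : nat -> nat) :=
  exists m k, (m < k)%N /\ forall n, d (m + n)%N = d (k + n)%N.

Definition matches (d : nat -> nat) (x : int -> nat) (i : int) (n : nat) :=
  forall l : nat, (l < n)%N -> x (i + l%:Z)%R = d l.

Definition admissible (d : nat -> nat) (x : int -> nat) :=
  forall i n, matches d x i n -> (x (i + n%:Z)%R <= d n)%N.

Definition digits (b : nat) (x : config 'I_b.+1) : int -> nat :=
  fun i => nat_of_ord (x i : 'I_b.+1).

Definition of_digits (b : nat) (x : int -> nat) : config 'I_b.+1 :=
  fun i => inord (x i).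

Arguments of_digits : clear implicits.

Lemma of_digitsK b x : (forall i, (x i <= b)%N) -> digits (of_digits b x) = x.
Proof. by move=> h; apply: funext => i; rewrite /digits inordK // ltnS. Qed.

Definition admissible_shift (d : nat -> nat) (b : nat) :
    set (config 'I_b.+1) := [set x | admissible d (digits x)].

Section Admissible.
Variables (d : nat -> nat) (b : nat).
Local Notation X := (@admissible_shift d b).

(** A forbidden block of a gluing has to cross the cut, since u and t are
admissible: its left part is a prefix of d matched by u, and the right ray of t
exceeds the corresponding tail of d. *)
Lemma glue_not_admissible k u t : X u -> X t -> ~ X (glue k u t) ->
  exists m n, [/\ matches d (digits u) (k - m%:Z) m,
    forall l, (l < n)%N -> digits t (k + l%:Z)%R = d (m + l)%N
    & (d (m + n)%N < digits t (k + n%:Z)%R)%N].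
Proof.
move=> Xu Xt /existsNP[i /existsNP[q /not_implyP[hm /negP]]].
rewrite -ltnNge => hq.
have gu n : n < k -> digits (glue k u t) n = digits u n.
  by rewrite /digits /glue => ->.
have gt n : k <= n -> digits (glue k u t) n = digits t n.
  by rewrite /digits /glue leNgt => /negbTE ->.
have [ki|ik] := leP k i.
  suff /Xt : matches d (digits t) i q by rewrite leqNgt -gt ?hq //; lia.
  by move=> l lq; rewrite -gt ?hm //; lia.
have [qk|kq] := ltP (i + q%:Z)%R k.
  suff /Xu : matches d (digits u) i q by rewrite leqNgt -gu ?hq.
  by move=> l lq; rewrite -gu ?hm //; lia.
pose m := `|k - i|%N; have e : i = k - m%:Z by lia.
exists m, (q - m)%N; split.
- by move=> l lm; rewrite -gu -?e ?hm //; lia.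
- by move=> l lm; rewrite -gt -?hm //; [congr digits; lia|lia|lia].
- have -> : (m + (q - m) = q)%N by lia.
  by rewrite -gt; [rewrite (_ : k + _ = i + q%:Z) //; lia|lia].
Qed.

(** The right ray of t exceeds a tail of d that bounds the right ray of u, and
conversely.  The two lexicographic comparisons contradict each other at the
earlier one of the two first differences. *)
Lemma admissible_nested : nested 0 X.
Proof.
move=> k u t Xu Xt _; apply: contrapT => /not_orP[].
move=> /(glue_not_admissible Xu Xt)[m [n [um tn tgt]]].
move=> /(glue_not_admissible Xt Xu)[m' [n' [tm un ugt]]].
(* By symmetry, let the first difference of t from its bound come first. *)
wlog nn' : u t Xu Xt m n um tn tgt m' n' tm un ugt / (n <= n')%N.
  move=> W; have [le_n|/ltnW le_n] := leqP n n'.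
    exact: (W u t Xu Xt m n um tn tgt m' n' tm un ugt).
  exact: (W t u Xt Xu m' n' tm un ugt m n um tn tgt).
have bound x p q : X x -> matches d (digits x) (k - p%:Z) p ->
    (forall l, (l < q)%N -> digits x (k + l%:Z)%R = d (p + l)%N) ->
    (digits x (k + q%:Z)%R <= d (p + q)%N)%N.
  move=> Xx xp xq; have := Xx (k - p%:Z) (p + q)%N.
  rewrite (_ : k - p%:Z + (p + q)%N%:Z = k + q%:Z); last by lia.
  apply=> l lpq; have [lp|pl] := ltnP l p; first exact: xp.
  rewrite (_ : k - _ + _ = k + (l - p)%N%:Z); last by lia.
  by rewrite xq; [congr d; lia|lia].
have e q : (q <= n)%N -> forall l, (l < q)%N -> d (m + l)%N = d (m' + l)%N.
  elim: q => // q IH qn l; rewrite ltnS leq_eqVlt => /orP[/eqP->|]; last first.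
    by apply: IH; exact: ltnW.
  have E := IH (ltnW qn); apply/eqP; rewrite eqn_leq; apply/andP; split.
    rewrite -tn //; apply: bound => // l' l'q.
    by rewrite tn ?E //; lia.
  rewrite -un; last by lia.
  apply: bound => // l' l'q.
  by rewrite un ?E //; lia.
have {}e := e n (leqnn n).
have u_n : (digits u (k + n%:Z)%R <= d (m + n)%N)%N.
  by apply: bound => // l ln; rewrite un ?e //; lia.
have t_n : (digits t (k + n%:Z)%R <= d (m' + n)%N)%N.
  by apply: bound => // l ln; rewrite tn ?e //; lia.
have u_n' : (d (m' + n)%N <= digits u (k + n%:Z)%R)%N.
  move: nn'; rewrite leq_eqVlt => /orP[/eqP ->|nn']; first exact: ltnW.
  by rewrite un.
by lia.
Qed.

(** If u matches only prefixes of length at most N before k, then every left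
ray with the same last N letters matches them too, so it has no followers that
are refused to u. *)
Lemma not_critical N u k : X u ->
  (forall m, matches d (digits u) (k - m%:Z) m -> (m <= N)%N) ->
  ~ critical N X u k.
Proof.
move=> Xu uN [t [Xt e nX]].
have [m [n [um tn]]] := glue_not_admissible Xu Xt nX.
have mN := uN m um; have := Xt (k - m%:Z) (m + n)%N.
rewrite (_ : k - m%:Z + (m + n)%N%:Z = k + n%:Z); last by lia.
rewrite ltnNge => -> // l lmn; have [lm|ml] := ltnP l m.
  by rewrite -um // /digits -e //; lia.
rewrite (_ : k - _ + _ = k + (l - m)%N%:Z); last by lia.
by rewrite tn; [congr d; lia|lia].
Qed.

Hypotheses (d_adm : self_admissible d) (d_aper : ~ eventually_periodic d).

(** Self-admissibility makes a broken match lose everything: if the next digit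
is smaller than d m after a longest match of length m, it is smaller than d m'
for each shorter match m', so no prefix of positive length matches afterwards.
Criticality forbids this, hence the longest match grows forever.  Periodicity
on the left is what guarantees that a longest match exists: arbitrarily long
matches would make d periodic.  Two-sided limits of translates of d, which may
be critical everywhere, are excluded in this way. *)
Lemma critical_tail N u (K : int) p (K' : int) : X u ->
  (forall n : nat, critical N X u (K + n%:Z)%R) ->
  (0 < p)%N -> (forall n : int, n <= K' -> u (n - p%:Z) = u n) ->
  exists m, forall n : nat, digits u (K + n%:Z)%R = d (m + n)%N.
Proof.
move=> Xu ucrit p0 uper; pose M k m := matches d (digits u) (k - m%:Z) m.
have Mbound k : exists c, forall m, M k m -> (m <= c)%N.
  apply: contrapT => /forallNP h; apply: d_aper; exists 0%N, p; split=> // n.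
  have [m /not_implyP[Mm /negP]] : exists m,
      ~ (M k m -> (m <= n + p + `|k - K'|)%N).
    exact/existsNP/h.
  rewrite -ltnNge => ml.
  rewrite -(Mm (p + n)%N); last by lia.
  rewrite -(Mm (0 + n)%N); last by lia.
  rewrite /digits -[in RHS]uper; last by lia.
  by congr nat_of_ord; congr u; lia.
have Mstep k m : M (k + 1) m.+1 -> M k m /\ digits u k = d m.
  move=> h; split=> [l lm|].
    by rewrite -h; [congr digits; lia|lia].
  by rewrite -h //; congr digits; lia.
have Mgrow k m : M k m -> digits u k = d m -> M (k + 1) m.+1.
  move=> h e l; rewrite ltnS leq_eqVlt => /orP[/eqP->|lm].
    by rewrite -e; congr digits; lia.
  by rewrite -h //; congr digits; lia.
have Mle k m : M k m -> (digits u k <= d m)%N.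
  by move/Xu; rewrite subrK.
have pos k : (forall n : nat, critical N X u (k + n%:Z)%R) ->
    exists2 m, M k m & (0 < m)%N.
  move=> uc; apply: contrapT => /forall2NP h.
  have := uc 0%N; rewrite addr0; apply: not_critical => // m Mm.
  by case: (h m) => // /negP; lia.
have maxM k : exists2 m, M k m & forall m', M k m' -> (m' <= m)%N.
  have ex : exists m, `[< M k m >] by exists 0%N; apply/asboolP.
  have [c hc] := Mbound k.
  have bd m : `[< M k m >] -> (m <= c)%N by move/asboolP/hc.
  case: (ex_maxnP ex bd) => m /asboolP Mm h; exists m => // m' Mm'.
  by apply: h; apply/asboolP.
have [m Mm mmax] := maxM K; exists m.
suff H n : [/\ M (K + n%:Z)%R (m + n)%N &
    forall m', M (K + n%:Z)%R m' -> (m' <= m + n)%N] /\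
    digits u (K + n%:Z)%R = d (m + n)%N.
  by move=> n; case: (H n).
have step k q : M k q -> (forall m', M k m' -> (m' <= q)%N) ->
    (exists2 m', M (k + 1) m' & (0 < m')%N) -> digits u k = d q.
  move=> Mq qmax [[//|m'] /Mstep[Mm' um'] _].
  apply/eqP; rewrite eqn_leq Mle //= um'.
  have := qmax _ Mm' => m'q.
  have := @d_adm (q - m')%N m'; rewrite subnK //; apply=> l lm'.
  rewrite -[RHS]Mm' // -[LHS]Mq; last by lia.
  by congr digits; lia.
elim: n => [|n [[Mn nmax] un]].
  rewrite addr0 addn0; split; first by [].
  apply: step => //; apply: pos => n; have := ucrit n.+1.
  by rewrite (_ : K + n.+1%:Z = K + 1 + n%:Z) //; lia.
have e : K + n.+1%:Z = K + n%:Z + 1 by lia.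
have M1 : M (K + n.+1%:Z)%R (m + n.+1)%N by rewrite e addnS; exact: Mgrow.
have max1 m' : M (K + n.+1%:Z)%R m' -> (m' <= m + n.+1)%N.
  by case: m' => // m'; rewrite e => /Mstep[/nmax]; lia.
split=> //; apply: step => //; apply: pos => q.
have -> : K + n.+1%:Z + 1 + q%:Z = K + (n.+2 + q)%N%:Z by lia.
exact: ucrit.
Qed.

Hypotheses (d0 : (0 < d 0)%N) (db : forall n, (d n <= b)%N).

Definition digit_ray : int -> nat := fun i => if i is Posz n then d n else 0%N.

Lemma digit_ray_config : digits (of_digits b digit_ray) = digit_ray.
Proof. by apply: of_digitsK => -[n|n] //=. Qed.

Lemma digit_ray_admissible : admissible d digit_ray.
Proof.
move=> [j|j] n h.
  by apply: d_adm => l ln; have := h l ln.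
case: n h => [|n] h; first by rewrite addr0.
by have := h 0%N isT; rewrite addr0 /= => e; move: d0; rewrite -e.
Qed.

(** Before position k the ray matches a prefix of length k, whereas the window
of its last N letters only forces some longest match of length m <= N.
A left ray that is 0 before this window may be followed by the tail of d at
m, which exceeds the tail at k because the tails differ. *)
Lemma digit_ray_critical N k : (N < k)%N ->
  critical N X (of_digits b digit_ray) k%:Z.
Proof.
move=> Nk.
pose P m := (m <= N)%N && [forall l : 'I_m, d (k - m + l)%N == d l].
have P0 : exists m, P m.
  exists 0%N; apply/andP; split=> //.
  by apply/forallP; case.
have PN m : P m -> (m <= N)%N by case/andP.
case: (ex_maxnP P0 PN) => m /andP[mN /forallP dm] maxm.
have {}dm l : (l < m)%N -> d (k - m + l)%N = d l.
  by move=> lm; have /eqP := dm (Ordinal lm).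
(* t is 0, then agrees with the ray on the window, and restarts d at k - m. *)
pose t (i : int) := if i is Posz n then
   if (n < k - N)%N then 0%N else if (n < k)%N then d n else d (n - (k - m))%N
  else 0%N.
have tK : digits (of_digits b t) = t.
  by apply: of_digitsK => -[n|n] //=; case: ifP => // _; case: ifP.
have tlow i : (i < (k - N)%N%:Z) -> t i = 0%N.
  by case: i => [n|n] // h; rewrite /t ifT //; lia.
have tmid n : (k - N <= n < k)%N -> t n%:Z = d n.
  by case/andP=> h1 h2; rewrite /t ltnNge h1 h2.
have thigh n : (k - m <= n)%N -> t n%:Z = d (n - (k - m))%N.
  move=> h; rewrite /t ltnNge (_ : (k - N <= n)%N) /=; last by lia.
  by case: ifP => // nk; rewrite -[RHS]dm; [congr d; lia|lia].
have tadm : admissible d t.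
  move=> i n h; have [lo|hi] := ltP i (k - N)%N%:Z.
    case: n h => [|n] h; first by rewrite addr0 tlow.
    by have := h 0%N isT; rewrite addr0 tlow // => e; move: d0; rewrite -e.
  case: i h hi => // i h hi.
  have [im|mi] := ltnP i (k - m); last first.
    rewrite -PoszD thigh; last by lia.
    rewrite (_ : (i + n - _ = i - (k - m) + n)%N); last by lia.
    apply: d_adm => l ln; have := h l ln; rewrite -PoszD thigh; last by lia.
    by move=> <-; congr d; lia.
  have [ink|kin] := ltnP (i + n) k.
    rewrite -PoszD tmid; last by lia.
    apply: d_adm => l ln; have := h l ln; rewrite -PoszD tmid //; lia.
  suff : P (k - i)%N by move/maxm; lia.
  apply/andP; split; first by lia.
  apply/forallP => -[l /= lk]; apply/eqP; have := h l.
  rewrite -PoszD tmid; last by lia.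
  by move=> <-; [congr d; lia|lia].
exists (of_digits b t); split; first by rewrite /admissible_shift /= tK.
  move=> n nk; rewrite /of_digits; congr inord.
  case: n nk => n nk; last by lia.
  by rewrite tmid //; lia.
have [n en minn] : exists2 n, d (k + n)%N <> d (m + n)%N &
    forall l, (l < n)%N -> d (k + l)%N = d (m + l)%N.
  have /existsNP[n0 hn0] : ~ forall n, d (m + n)%N = d (k + n)%N.
    by move=> h; apply: d_aper; exists m, k; split=> //; lia.
  have ex : exists n, d (k + n)%N != d (m + n)%N.
    by exists n0; apply/eqP => e; exact: hn0.
  case: (ex_minnP ex) => n /eqP en mn; exists n => // l ln.
  by apply: contrapT => /eqP/mn; lia.
have lt_n : (d (k + n)%N < d (m + n)%N)%N.
  rewrite ltn_neqAle; apply/andP; split; first exact/eqP.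
  have := @d_adm (k - m)%N (m + n)%N.
  rewrite (_ : (k - m + (m + n) = k + n)%N); last by lia.
  apply=> l lmn; have [lm|ml] := ltnP l m; first exact: dm.
  have := minn (l - m)%N.
  rewrite (_ : (k - m + l = k + (l - m))%N); last by lia.
  by move=> ->; [congr d; lia|lia].
move=> Xg; pose g := digits (glue k%:Z (of_digits b digit_ray) (of_digits b t)).
have glow l : (l < k)%N -> g l%:Z = d l.
  move=> lk; rewrite /g /digits /glue ifT; last by lia.
  by have := congr1 (fun z => z l%:Z) digit_ray_config.
have ghigh l : g (k + l)%N%:Z = d (m + l)%N.
  rewrite /g /digits /glue ifF; last by lia.
  have := congr1 (fun z => z (k + l)%N%:Z) tK; rewrite /digits => ->.
  by rewrite thigh; [congr d; lia|lia].
have := Xg 0 (k + n)%N; rewrite -/g add0r ghigh leqNgt lt_n => h.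
suff : ~~ true by []; apply: h => l lkn; rewrite add0r.
have [/glow//|kl] := ltnP l k.
have := ghigh (l - k)%N; rewrite subnKC // => ->.
by rewrite -minn; [congr d; lia|lia].
Qed.

End Admissible.

(** * The beta-shift as an admissible shift *)

Section BetaShiftAdmissible.
Variables (R : realType) (beta : R).
Hypothesis (beta_gt1 : 1 < beta).
Local Notation d := (beta_digit beta).
Local Notation b := (Num.truncn beta).

Lemma beta_digit0_gt0 : (0 < d 0)%N.
Proof. by rewrite /beta_digit /= mulr1 truncn_gt0 ltW. Qed.

(** As long as the expansions of two orbit points agree, [beta_map] multiplies
their difference by beta and so keeps their order.  Every orbit point is at
most 1, whose expansion is d. *)
Lemma beta_digit_self_admissible : self_admissible d.
Proof.
have b0 : 0 <= beta by apply: ltW; apply: lt_trans beta_gt1.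
pose t i := iter i (beta_map beta) 1.
have t_itv i : 0 <= t i <= 1.
  by case: i => [|i]; [rewrite /t /= ler01 lexx|exact: beta_map_itv].
have tS i : t i.+1 = beta * t i - (d i)%:R.
  have bt0 : 0 <= beta * t i by apply: mulr_ge0 => //; case/andP: (t_itv i).
  rewrite /t /= {1}/beta_map -/(t i); congr (_ - _).
  rewrite /beta_digit -/(t i) truncn_floor bt0 natr_absz ger0_norm //.
  by rewrite floor_ge0.
have t_le j n : (forall l, (l < n)%N -> d (j + l)%N = d l) ->
    t (j + n)%N <= t n.
  elim: n => [|n IH] h; first by rewrite addn0; case/andP: (t_itv j).
  rewrite addnS !tS h // lerD2r; apply: ler_wpM2l => //.
  by apply: IH => l ln; apply: h; exact: ltnW.
move=> j n h; apply: le_truncn; apply: ler_wpM2l => //; exact: t_le.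
Qed.

(** A prefix of d of length n begins some code word exactly when a nonzero
digit occurs at n or later.  This can fail when d ends in zeros. *)
Definition completable n := exists n', (n <= n')%N /\ (0 < d n')%N.

Lemma beta_language_rcons us n : (forall u, u \in us -> beta_code beta u) ->
  completable n -> beta_language beta (flatten us ++ mkseq d n).
Proof.
move=> hus [n' [nn' dn']].
exists (us ++ [:: rcons (mkseq d n') 0%N]); split.
  by move=> u; rewrite mem_cat inE => /orP[/hus//|/eqP ->]; exists n', 0%N.
rewrite flatten_cat /= cats0; apply/infixP.
exists [::], (drop n (rcons (mkseq d n') 0%N)) => /=.
rewrite -catA; congr cat; rewrite -[LHS](cat_take_drop n); congr cat.
by rewrite -cats1 takel_cat ?size_mkseq // -map_take take_iota (minn_idPl nn').
Qed.

(** A match of d that starts inside a code word cannot run past its last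
letter c, which is strictly smaller than the digit of d at its place, while
this digit is at most the one that a match would require. *)
Lemma beta_language_matches w : beta_language beta w ->
  forall i n, (i + n <= size w)%N ->
    (forall l, (l < n)%N -> nth 0%N w (i + l) = d l) ->
    ((i + n < size w)%N -> (nth 0%N w (i + n) <= d n)%N) /\ completable n.
Proof.
move=> [us [hus /infixP[p [s us_eq]]]] i n inw h.
suff main i' : (i' + n <= size (flatten us))%N ->
    (forall l, (l < n)%N -> nth 0%N (flatten us) (i' + l) = d l) ->
    ((i' + n < size (flatten us))%N ->
      (nth 0%N (flatten us) (i' + n) <= d n)%N) /\ completable n.
  have nthw l : (l < size w)%N ->
      nth 0%N (flatten us) (size p + l) = nth 0%N w l.
    by move=> lw; rewrite us_eq nth_cat ltnNge leq_addr /= addKn nth_cat lw.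
  have szw : (size p + size w <= size (flatten us))%N.
    by rewrite us_eq !size_cat addnA leq_addr.
  have [|l ln|h1 h2] := main (size p + i)%N; first by lia.
    by rewrite -addnA nthw ?h //; lia.
  split=> // inw'; rewrite -nthw // addnA; apply: h1; lia.
move=> {i inw h us_eq p s w}; elim: us hus i' => [_ i|u us IH hus i].
  rewrite /= leqn0 addn_eq0 => /andP[/eqP -> /eqP ->] _; split=> //.
  by exists 0%N; split=> //; exact: beta_digit0_gt0.
have [q [c [cq uE]]] : beta_code beta u by apply: hus; rewrite mem_head.
have szu : size u = q.+1 by rewrite uE size_rcons size_mkseq.
rewrite /= size_cat szu => ilen h.
have [iq|qi] := leqP i q; last first.
  have nthR l : nth 0%N (u ++ flatten us) (i + l) =
      nth 0%N (flatten us) (i - q.+1 + l).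
    by rewrite nth_cat szu ifF; [congr nth; lia|lia].
  have hus' v : v \in us -> beta_code beta v.
    by move=> vus; apply: hus; rewrite inE vus orbT.
  have [|l ln|h1 h2] := IH hus' (i - q.+1)%N.
  - by lia.
  - by rewrite -nthR h.
  by split=> // il; rewrite nthR h1 //; lia.
have nthd l : (i + l < q)%N -> nth 0%N (u ++ flatten us) (i + l) = d (i + l)%N.
  move=> ilq; rewrite nth_cat szu ifT; last by lia.
  by rewrite uE nth_rcons size_mkseq ilq nth_mkseq.
have nthc : nth 0%N (u ++ flatten us) q = c.
  by rewrite nth_cat szu ltnSn uE nth_rcons size_mkseq ltnn eqxx.
have dle l : (l <= n)%N -> (i + l <= q)%N -> (d (i + l)%N <= d l)%N.
  move=> ln lq; apply: beta_digit_self_admissible => l' l'l.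
  by rewrite -nthd ?h //; lia.
have inq : (i + n <= q)%N.
  rewrite leqNgt; apply/negP => qin.
  have := h (q - i)%N; rewrite subnKC // nthc => cE.
  have := dle (q - i)%N; rewrite subnKC // -cE; lia.
split; last by exists q; lia.
move=> _; move: inq; rewrite leq_eqVlt => /orP[/eqP e|inq].
  by rewrite e nthc; have := dle n (leqnn n); rewrite e => /(_ (leqnn q)); lia.
by rewrite nthd // dle //; lia.
Qed.

Lemma nth_block (x : config 'I_b.+1) i n l : (l < n)%N ->
  nth 0%N (map val (block x i n)) l = digits x (i + l%:Z).
Proof. by move=> ln; rewrite /block /mkseq -map_comp nth_mkseq. Qed.

Lemma size_val_block (x : config 'I_b.+1) i n :
  size (map val (block x i n)) = n.
Proof. by rewrite size_map size_mkseq. Qed.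

Lemma val_blockS (x : config 'I_b.+1) i n :
  map val (block x i n.+1) =
  rcons (map val (block x i n)) (digits x (i + n%:Z)).
Proof. by rewrite /block mkseqS map_rcons. Qed.

(** For the converse, an admissible block is parsed greedily: follow d until a
smaller digit closes a code word, then start again.  The pending prefix at the
end of the block is the reason for the condition of completability. *)
Lemma beta_shift_admissible_completable (x : config 'I_b.+1) :
  beta_shift beta x <->
  admissible d (digits x) /\
  (forall i n, matches d (digits x) i n -> completable n).
Proof.
split=> [hx|[xadm xcomp] i n].
  have main i n : matches d (digits x) i n ->
      (digits x (i + n%:Z)%R <= d n)%N /\ completable n.
    move=> h; have := beta_language_matches (hx i n.+1) (i := 0) (n := n).
    rewrite size_val_block !add0n nth_block // => -[|l ln|h1 h2].
    - exact: leqnSn.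
    - by rewrite nth_block; [exact: h|exact: leqW].
    by split=> //; exact: h1.
  by split=> i n /main[].
suff [us [m [hus [mn [e xm]]]]] : exists us m,
    (forall u, u \in us -> beta_code beta u) /\ (m <= n)%N /\
    map val (block x i n) = flatten us ++ mkseq d m /\
    matches d (digits x) (i + n%:Z - m%:Z) m.
  by rewrite e; apply: beta_language_rcons => //; exact: xcomp xm.
elim: n => [|n [us [m [hus [mn [e xm]]]]]]; first by exists [::], 0%N.
have := xadm _ _ xm; rewrite subrK leq_eqVlt => /orP[/eqP xd|xd].
  exists us, m.+1; do ![split=> //].
    by rewrite val_blockS e xd mkseqS rcons_cat.
  move=> l; rewrite ltnS leq_eqVlt => /orP[/eqP ->|lm].
    by rewrite -xd; congr digits; lia.
  by rewrite -xm //; congr digits; lia.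
exists (rcons us (rcons (mkseq d m) (digits x (i + n%:Z)))), 0%N.
split.
  move=> u; rewrite mem_rcons inE => /orP[/eqP ->|/hus//].
  by exists m, (digits x (i + n%:Z)).
do ![split=> //].
by rewrite val_blockS e flatten_rcons cats0 rcons_cat.
Qed.

Lemma beta_shiftE : ~ eventually_periodic d ->
  beta_shift beta = @admissible_shift d b.
Proof.
move=> d_aper; apply/seteqP; split=> x.
  by case/beta_shift_admissible_completable.
move=> hx; apply/beta_shift_admissible_completable; split=> // i n _.
apply: contrapT => /forallNP h; apply: d_aper; exists n, n.+1; split=> // l.
have z n' : (n <= n')%N -> d n' = 0%N.
  by move=> nn'; apply/eqP; rewrite eqn0Ngt; apply/negP => ?; apply: (h n').
by rewrite !z //; lia.
Qed.

(** A block of x lies in a concatenation of code words, and repeating this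
concatenation stays in the language. *)
Lemma periodic_approximation (x : config 'I_b.+1) r : beta_shift beta x ->
  exists2 y, beta_shift beta y & cylinder x r y /\
    exists2 p : nat, (0 < p)%N & forall i : int, y (i + p%:Z) = y i.
Proof.
move=> hx; have [us [hus [pre [suf us_eq]]]] : exists us : seq (seq nat),
    (forall u, u \in us -> beta_code beta u) /\ exists pre suf : seq nat,
    flatten us = pre ++ map val (block x (- r%:Z) (2 * r).+1) ++ suf.
  have [us [hus /infixP[pre [suf us_eq]]]] := hx (- r%:Z) (2 * r).+1.
  by exists us; split=> //; exists pre, suf.
set w := map val _ in us_eq; pose U := flatten us.
have szw : size w = (2 * r).+1 by exact: size_val_block.
have U0 : (0 < size U)%N by rewrite /U us_eq !size_cat szw; lia.
have flU K : flatten (flatten (nseq K us)) = flatten (nseq K U).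
  by elim: K => //= K IH; rewrite flatten_cat IH.
have husK K u : u \in flatten (nseq K us) -> beta_code beta u.
  by case/flattenP => v; rewrite mem_nseq => /andP[_ /eqP ->]; exact: hus.
have szK K : size (flatten (nseq K U)) = (K * size U)%N.
  by elim: K => //= K IH; rewrite size_cat IH mulSn.
have nthK K q : (q < K * size U)%N ->
    nth 0%N (flatten (nseq K U)) q = nth 0%N U (q %% size U).
  elim: K q => // K IH q /=; rewrite mulSn nth_cat => qK.
  case: ltnP => [qU|Uq]; first by rewrite modn_small.
  by rewrite IH; [rewrite -{2}(subnK Uq) modnDr|lia].
have langU : beta_language beta U by exists us; split=> //; exact: infix_refl.
pose idx (i : int) : nat := `|((i + r%:Z + (size pre)%:Z) %% (size U)%:Z)%Z|%N.
have idxE i : (idx i)%:Z = ((i + r%:Z + (size pre)%:Z) %% (size U)%:Z)%Z.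
  by rewrite /idx gez0_abs // modz_ge0 //; lia.
have idxU i : (idx i < size U)%N.
  have := ltz_pmod (i + r%:Z + (size pre)%:Z) (_ : 0 < (size U)%:Z).
  by rewrite -idxE; lia.
have idxD i (l : nat) : idx (i + l%:Z) = ((idx i + l) %% size U)%N.
  apply/eqP; rewrite -eqz_nat -modz_nat PoszD !idxE modzDml; apply/eqP.
  by congr (_ %% _)%Z; lia.
pose y := of_digits b (fun i => nth 0%N U (idx i)).
have yE : digits y = fun i => nth 0%N U (idx i).
  apply: of_digitsK => i; apply: beta_language_bounded beta_gt1 langU _.
  by rewrite mem_nth.
exists y.
  move=> i n; exists (flatten (nseq (n.+1) us)); split; first exact: husK.
  rewrite flU; have sz : (n <= size (drop (idx i) (flatten (nseq n.+1 U))))%N.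
    rewrite size_drop szK mulSn; have := idxU i; have := leq_pmulr n U0; lia.
  have -> : map val (block y i n) =
      take n (drop (idx i) (flatten (nseq n.+1 U))).
    apply: (@eq_from_nth _ 0%N); first by rewrite size_val_block size_takel.
    move=> l; rewrite size_val_block => ln.
    rewrite nth_block // nth_take // nth_drop nthK ?yE ?idxD //.
    by move: sz; rewrite size_drop szK; lia.
  exact: infix_trans (infix_take _ _) (infix_drop _ _).
split.
  move=> k kr; pose l := `|(k + r%:Z)%R|%N.
  apply: (@ord_inj b.+1); rewrite -/(digits y k) -/(digits x k) yE.
  have -> : digits x k = nth 0%N w l.
    by rewrite nth_block; [congr digits; lia|lia].
  have -> : idx k = (size pre + l)%N.
    have kU : 0 <= k + r%:Z + (size pre)%:Z < (size U)%:Z.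
      by rewrite /U us_eq !size_cat szw; lia.
    by apply/eqP; rewrite -eqz_nat idxE (modz_small kU); apply/eqP; lia.
  rewrite /U us_eq nth_cat ifF; last by lia.
  by rewrite addKn nth_cat szw ifT //; lia.
exists (size U) => // i; rewrite /y /of_digits; congr (inord (nth _ _ _)).
by rewrite idxD modnDr modn_small.
Qed.

End BetaShiftAdmissible.

(** * Eventually periodic digits give a sofic shift *)

Definition same_tail (d : nat -> nat) (m n : nat) :=
  forall l, d (m + l)%N = d (n + l)%N.

Section Tails.
Variable d : nat -> nat.

Lemma same_tail_refl m : same_tail d m m. Proof. by []. Qed.

Lemma same_tail_sym m n : same_tail d m n -> same_tail d n m.
Proof. by move=> h l. Qed.

Lemma same_tail_trans m n p :
  same_tail d m n -> same_tail d n p -> same_tail d m p.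
Proof. by move=> h1 h2 l; rewrite h1. Qed.

Lemma same_tailS m n : same_tail d m n -> same_tail d m.+1 n.+1.
Proof. by move=> h l; rewrite !addSnnS. Qed.

Lemma same_tail_digit m n : same_tail d m n -> d m = d n.
Proof. by move/(_ 0%N); rewrite !addn0. Qed.

Lemma tail_class_ex n : exists s, `[< same_tail d n s >].
Proof. by exists n; apply/asboolP. Qed.

(** A canonical representative, so that indices with the same tail of d give
literally the same vertex of the graph. *)
Definition tail_class n := ex_minn (tail_class_ex n).

Lemma tail_classP n : same_tail d n (tail_class n).
Proof. by rewrite /tail_class; case: ex_minnP => s /asboolP. Qed.

Lemma tail_class_min n s : same_tail d n s -> (tail_class n <= s)%N.
Proof. by rewrite /tail_class; case: ex_minnP => ? _ h /asboolP/h. Qed.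

Lemma tail_class_eq m n : same_tail d m n -> tail_class m = tail_class n.
Proof.
move=> mn; apply/eqP; rewrite eqn_leq; apply/andP; split; apply: tail_class_min.
  exact: same_tail_trans mn (tail_classP n).
exact: same_tail_trans (same_tail_sym mn) (tail_classP m).
Qed.

Lemma tail_class_lt m k n :
  (m < k)%N -> same_tail d m k -> (tail_class n < k)%N.
Proof.
move=> mk dmk; elim/ltn_ind: n => n IH; have [nk|kn] := ltnP n k.
  exact: leq_ltn_trans (tail_class_min (same_tail_refl n)) nk.
have n'n : (n - k + m < n)%N by lia.
rewrite (@tail_class_eq n (n - k + m)) ?IH // => l.
have := dmk (n - k + l)%N.
rewrite (_ : (m + _ = n - k + m + l)%N); last by lia.
by move=> ->; congr d; lia.
Qed.

Hypothesis d_adm : self_admissible d.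

(** A match long enough that all longer ones leave the same tail of d.  A
longest match need not exist, and this tail is the right notion of state of the
left ray in either case. *)
Definition stable_match (x : int -> nat) (i : int) (m : nat) :=
  matches d x (i - m%:Z) m /\
  forall m', (m <= m')%N -> matches d x (i - m'%:Z) m' -> same_tail d m m'.

(** The shorter of two matches is a suffix of the longer one, so
self-admissibility compares the tails that they leave. *)
Lemma longer_match_le x i m m' q : (m <= m')%N ->
  matches d x (i - m%:Z) m -> matches d x (i - m'%:Z) m' ->
  (forall l, (l < q)%N -> d (m' + l)%N = d (m + l)%N) ->
  (d (m' + q)%N <= d (m + q)%N)%N.
Proof.
move=> mm' hm hm' e; have := @d_adm (m' - m)%N (m + q)%N.
rewrite (_ : (m' - m + (m + q) = m' + q)%N); last by lia.
apply=> l lmq; have [lm|ml] := ltnP l m.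
  by rewrite -[RHS]hm // -[LHS]hm'; [congr x; lia|lia].
rewrite (_ : (m' - m + l = m' + (l - m))%N); last by lia.
by rewrite e; [congr d; lia|lia].
Qed.

(** If the lengths of the matches are unbounded, one of the finitely many tails
occurs for unboundedly many of them.  The tails decrease lexicographically with
the length, so they are constant between two occurrences of that tail. *)
Lemma stable_match_ex m k x i : (m < k)%N -> same_tail d m k ->
  exists q, stable_match x i q.
Proof.
move=> mk dmk; pose M q := matches d x (i - q%:Z) q.
have [[c hc]|unb] := pselect (exists c, forall q, M q -> (q <= c)%N).
  have ex : exists q, `[< M q >] by exists 0%N; apply/asboolP.
  have bd q : `[< M q >] -> (q <= c)%N by move/asboolP/hc.
  case: (ex_maxnP ex bd) => q /asboolP Mq qmax; exists q; split=> // q' qq' Mq'.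
  have q'q : (q' <= q)%N by apply: qmax; apply/asboolP.
  by rewrite (_ : q' = q) //; lia.
have [s hs] : exists s : 'I_k, forall c, exists q,
    [/\ (c < q)%N, M q & tail_class q = s].
  apply: contrapT => /forallNP h; apply: unb.
  have /choice[c hc] : forall s : 'I_k, exists c, forall q,
      M q -> tail_class q = s -> (q <= c)%N.
    move=> s; have /existsNP[c hc] := h s; exists c => q Mq qs.
    by rewrite leqNgt; apply/negP => cq; apply: hc; exists q.
  exists (\max_(s : 'I_k) c s)%N => q Mq.
  have qk := tail_class_lt q mk dmk.
  have := hc (Ordinal qk) q Mq erefl.
  by move=> h'; apply: leq_trans h' (leq_bigmax (Ordinal qk)).
have [q [_ Mq qs]] := hs 0%N; exists q; split=> // q' qq' Mq'.
have [q'' [q'q'' Mq'' q''s]] := hs q'.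
have E : same_tail d q q''.
  apply: same_tail_trans (tail_classP q) _; rewrite qs -q''s.
  exact/same_tail_sym/tail_classP.
move=> l; elim/ltn_ind: l => l IH; apply/eqP; rewrite eqn_leq.
apply/andP; split.
  rewrite E; apply: longer_match_le Mq' Mq'' _ => [|l' l'l]; first exact: ltnW.
  by rewrite -E IH.
by apply: longer_match_le Mq Mq' _ => // l' l'l; rewrite IH.
Qed.

Lemma stable_match_class x i m m' : stable_match x i m -> stable_match x i m' ->
  tail_class m = tail_class m'.
Proof.
move=> [Mm hm] [Mm' hm'].
have [mm'|/ltnW m'm] := leqP m m'; first exact/tail_class_eq/hm.
exact/esym/tail_class_eq/hm'.
Qed.

Lemma stable_match_next x i m : stable_match x i m -> x i = d m ->
  stable_match x (i + 1) m.+1.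
Proof.
move=> [Mm hm] xi; split.
  move=> l; rewrite ltnS leq_eqVlt => /orP[/eqP ->|lm].
    by rewrite -xi; congr x; lia.
  by rewrite -Mm //; congr x; lia.
case=> // m' mm' Mm'; apply/same_tailS/hm => // l lm'.
by rewrite -Mm'; [congr x; lia|lia].
Qed.

Lemma stable_match_break x i m m' : stable_match x i m -> (x i < d m)%N ->
  stable_match x (i + 1) m' -> m' = 0%N.
Proof.
move=> [Mm hm] xi [+ _]; case: m' => // m' Mm'.
have xm' : x i = d m' by rewrite -Mm' //; congr x; lia.
have {}Mm' : matches d x (i - m'%:Z) m'.
  by move=> l lm'; rewrite -Mm'; [congr x; lia|lia].
have [mm'|m'm] := leqP m m'.
  by move: xi; rewrite (same_tail_digit (hm m' mm' Mm')) xm' ltnn.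
have := @longer_match_le x i m' m 0 (ltnW m'm) Mm' Mm.
rewrite !addn0 => h; suff : (d m <= d m')%N by lia.
by apply: h.
Qed.

End Tails.

Section Sofic.
Variables (R : realType) (beta : R).
Hypothesis (beta_gt1 : 1 < beta).
Local Notation d := (beta_digit beta).
Local Notation b := (Num.truncn beta).
Variables (m k : nat).
Hypotheses (mk : (m < k)%N) (dmk : same_tail d m k).

Let d_adm : self_admissible d := beta_digit_self_admissible beta_gt1.

Definition tail_state n : 'I_k := Ordinal (tail_class_lt n mk dmk).

(** A smaller digit returns to the initial state.  The digit of d itself is
allowed only if the longer prefix can still be completed to a code word; when
d ends in zeros this removes the paths that would read all of d. *)
Definition tail_edge (e : 'I_k * 'I_b.+1) : bool :=
  (e.2 < d e.1)%N || (e.2 == d e.1 :> nat) && `[< completable beta e.1.+1 >].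

Definition tail_target (e : 'I_k * 'I_b.+1) : 'I_k :=
  if (e.2 < d e.1)%N then tail_state 0 else tail_state e.1.+1.

Lemma tail_state_eq n n' : same_tail d n n' -> tail_state n = tail_state n'.
Proof. by move=> h; apply: val_inj; exact: tail_class_eq. Qed.

Lemma completable_same_tail n n' :
  same_tail d n n' -> completable beta n -> completable beta n'.
Proof.
move=> h [q [nq dq]]; exists (n' + (q - n))%N; split; first exact: leq_addr.
by rewrite -h subnKC.
Qed.

Lemma beta_shift_path (x : config 'I_b.+1) : beta_shift beta x ->
  exists s : int -> 'I_k, forall i, tail_edge (s i, x i : 'I_b.+1) /\
    tail_target (s i, x i : 'I_b.+1) = s (i + 1).
Proof.
move=> /(beta_shift_admissible_completable beta_gt1)[xadm xcomp].
have /choice[q hq] i : exists q, stable_match d (digits x) i q.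
  exact: stable_match_ex mk dmk.
exists (fun i => tail_state (q i)) => i.
have dq : d (tail_state (q i)) = d (q i).
  exact/esym/same_tail_digit/tail_classP.
have xi : (digits x i <= d (q i))%N.
  by have := xadm _ _ (hq i).1; rewrite subrK.
rewrite /tail_edge /tail_target /= dq -/(digits x i).
move: xi; rewrite leq_eqVlt => /orP[/eqP xi|xi]; last first.
  rewrite xi; split=> //; congr tail_state.
  exact/esym/(stable_match_break d_adm (hq i) xi (hq (i + 1))).
have st := stable_match_next (hq i) xi.
rewrite xi ltnn eqxx; split=> /=.
  apply/asboolP; apply: (completable_same_tail _ (xcomp _ _ st.1)).
  exact/same_tailS/tail_classP.
rewrite -(tail_state_eq (same_tailS (tail_classP d (q i)))).
by apply: val_inj; exact: stable_match_class st (hq (i + 1)).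
Qed.

Lemma path_beta_shift (x : config 'I_b.+1) (s : int -> 'I_k) :
  (forall i, tail_edge (s i, x i : 'I_b.+1) /\
    tail_target (s i, x i : 'I_b.+1) = s (i + 1)) -> beta_shift beta x.
Proof.
move=> hs i n.
have comp j : completable beta (s j).
  have [/orP[h|/andP[_ /asboolP[q [sq dq]]]] _] := hs j.
    by exists (s j); split=> //; exact: leq_ltn_trans h.
  by exists q; split=> //; exact: ltnW.
suff [us [q [hus [e qs]]]] : exists us q,
    (forall u, u \in us -> beta_code beta u) /\
    mkseq d (s i) ++ map val (block x i n) = flatten us ++ mkseq d q /\
    same_tail d q (s (i + n%:Z)).
  apply: (@beta_language_infix _ _ _ (flatten us ++ mkseq d q)).
    by rewrite -e; exact: suffixW (suffix_suffix _ _).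
  apply: beta_language_rcons => //.
  exact: completable_same_tail (same_tail_sym qs) (comp _).
elim: n => [|n [us [q [hus [e qs]]]]].
  by exists [::], (s i : nat); rewrite /= cats0 addr0.
have [edge tgt] := hs (i + n%:Z).
rewrite /tail_edge /tail_target /= in edge tgt.
have dq := same_tail_digit qs.
have e' : i + n.+1%:Z = i + n%:Z + 1 by lia.
rewrite val_blockS e' -tgt -rcons_cat e rcons_cat.
case: ifPn edge => [lt_d _|_ /= /andP[/eqP xd _]].
  exists (rcons us (rcons (mkseq d q) (digits x (i + n%:Z)))), 0%N; split.
    move=> u; rewrite mem_rcons inE => /orP[/eqP ->|/hus//].
    by exists q, (digits x (i + n%:Z)); rewrite dq.
  by rewrite flatten_rcons cats0; split=> //; exact: tail_classP.
exists us, q.+1; rewrite mkseqS dq -xd; do ![split=> //].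
exact: same_tail_trans (same_tailS qs) (tail_classP d _).
Qed.

Lemma periodic_sofic : sofic (beta_shift beta).
Proof.
exists 'I_k, {e : 'I_k * 'I_b.+1 | tail_edge e},
  (fun e => (val e).1), (fun e => tail_target (val e)), (fun e => (val e).2).
apply/seteqP; split=> x /=.
  move/beta_shift_path => [s hs].
  by exists (fun i => exist (fun e => tail_edge e) _ (hs i).1) => i;
    split=> //=; exact: (hs i).2.
move=> [p hp]; apply: (@path_beta_shift _ (fun i => (val (p i)).1)) => i.
have [tp xp] := hp i.
have -> : ((val (p i)).1, x i : 'I_b.+1) = val (p i).
  by rewrite xp -surjective_pairing.
by split=> //; exact: valP.
Qed.

End Sofic.

Lemma not_sofic_aperiodic (R : realType) (beta : R) : 1 < beta ->
  ~ sofic (beta_shift beta) -> ~ eventually_periodic (beta_digit beta).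
Proof.
move=> beta1 ns [m [k [mk dmk]]]; apply: ns.
exact: (periodic_sofic beta1 mk dmk).
Qed.

(** * Factorizations of an admissible shift *)

Lemma translate_periodic (T : Type) (z : int -> T) (p q : nat) :
  (forall i : int, z (i + p%:Z) = z i) -> forall i, z (i + (q * p)%N%:Z) = z i.
Proof.
move=> h i; elim: q => [|q IH]; first by rewrite mul0n addr0.
by rewrite -IH -[RHS]h; congr z; lia.
Qed.

Section Factorization.
Variables (d : nat -> nat) (b : nat).
Hypotheses (d_adm : self_admissible d) (d0 : (0 < d 0)%N).
Hypotheses (db : forall n, (d n <= b)%N) (d_aper : ~ eventually_periodic d).
Local Notation X := (@admissible_shift d b).
Hypothesis X_periodic : forall x r, X x -> exists2 y, X y & cylinder x r y /\
    exists2 p : nat, (0 < p)%N & forall i : int, y (i + p%:Z) = y i.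
Variables (n : nat) (B : 'I_n -> finType) (Y : forall i, set (config (B i))).
Arguments Y : clear implicits.
Local Notation D := {dffun forall i : 'I_n, B i}.
Local Notation P := (product_shift Y).
Hypothesis Y_inv : forall i, shift_invariant (Y i).
Variables (f : config 'I_b.+1 -> config D) (g : config D -> config 'I_b.+1).
Variable r : nat.
Hypotheses (fP : forall x, X x -> P (f x)) (gX : forall y, P y -> X (g y)).
Hypotheses (fK : forall y, P y -> f (g y) = y).
Hypotheses (gK : forall x, X x -> g (f x) = x).
Hypotheses (lf : local_rule r X f) (lg : local_rule r P g).

Let ray : config 'I_b.+1 := of_digits b (digit_ray d).

Let ray_digits : digits ray = digit_ray d.
Proof. exact: digit_ray_config. Qed.

Let Xray : X ray.
Proof.
by rewrite /admissible_shift /= ray_digits; exact: digit_ray_admissible.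
Qed.

Let w0 : config D := f ray.

Let Pw0 : P w0. Proof. exact: fP. Qed.

(** The numbers 6r, 4r and 2r in this part are windows of criticality: each
passage through the conjugacy costs 2r, and a window of length 4r is needed
before a passage and for nesting in the product. *)
Lemma critical_coordinate : exists i, forall K : int, (5 * r).+1%:Z <= K ->
  critical (4 * r) (Y i) (coord i w0) K.
Proof.
have ex (K : int) : (5 * r).+1%:Z <= K ->
    exists i, critical (4 * r) (Y i) (coord i w0) K.
  move=> hK; apply: critical_product => //.
  have rayK : critical (6 * r) X ray `|(K + r%:Z)%R|%N%:Z.
    by apply: digit_ray_critical => //; lia.
  have := critical_transfer fP gX gK lf lg Xray _ rayK.
  rewrite (_ : `|(K + r%:Z)%R|%N%:Z - r%:Z = K); last by lia.
  by rewrite (_ : (6 * r - 2 * r = 4 * r)%N); [apply|]; lia.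
have [i hi] := ex _ (lexx _); exists i => K /ex[j hj].
have nP : nested (4 * r) P.
  exact: (nested_transfer fP gX fK lf lg (@admissible_nested d b)
    (leqnn _)).
have ci := critical_translate (5 * r).+1%:Z (@Y_inv i) hi.
have cj := critical_translate K (@Y_inv j) hj.
rewrite !subrr in ci cj.
have Yi : Y i (translate (5 * r).+1%:Z (coord i w0)).
  by apply: Y_inv; exact: Pw0.
have Yj : Y j (translate K (coord j w0)) by apply: Y_inv; exact: Pw0.
have ij := nested_product_critical nP Pw0 Yi Yj ci cj.
by case: j / ij hj {cj Yj}.
Qed.

Lemma left_ray_constant (a c : int) : a < - r%:Z -> c < - r%:Z -> w0 a = w0 c.
Proof.
move=> ha hc; apply: lf => // l lr; rewrite /ray /of_digits.
have neg q : q < 0 -> digit_ray d q = 0%N by case: q => // q; lia.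
by rewrite !neg //; lia.
Qed.

Section OtherCoordinate.
Variables (i j : 'I_n).
Hypotheses (ij : i != j) (i_crit : forall K : int, (5 * r).+1%:Z <= K ->
  critical (4 * r) (Y i) (coord i w0) K).

Lemma periodic_right_tail z p : Y j z -> (0 < p)%N ->
  (forall k : int, z (k + p%:Z) = z k) ->
  exists c K : int, forall k, K <= k -> z k = coord j w0 (k + c).
Proof.
move=> Yz p0 zper; pose v := update j w0 z.
have Pv : P v by exact: update_product.
have vi : coord i w0 = coord i v by rewrite coord_update_neq // eq_sym.
have vj : coord j v = z by rewrite coord_update.
have vcrit (K : int) : (5 * r).+1%:Z <= K -> critical (4 * r) P v K.
  by move=> hK; exact: critical_update Pv (i_crit hK) vi.
have ucrit (q : nat) : critical (2 * r) X (g v) ((4 * r).+1%:Z + q%:Z).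
  have hq : (5 * r).+1%:Z <= (5 * r).+1%:Z + q%:Z by lia.
  have := critical_transfer gX fP fK lg lf Pv (leqnn _) (vcrit _ hq).
  rewrite (_ : (4 * r - 2 * r = 2 * r)%N); last by lia.
  by rewrite (_ : (5 * r).+1%:Z + q%:Z - r%:Z = (4 * r).+1%:Z + q%:Z) //; lia.
have uleft (q : int) : q <= - (2 * r).+1%:Z -> g v (q - p%:Z) = g v q.
  move=> hq; apply: lg => // l lr; apply/ffunP => s.
  rewrite -/(coord s v (q - p%:Z + l)) -/(coord s v (q + l)).
  have [js|js] := eqVneq j s.
    case: s / js; rewrite vj -zper; congr z; lia.
  rewrite coord_update_neq // /coord (@left_ray_constant _ (q + l)) //; lia.
have [m um] := critical_tail d_adm d_aper (gX Pv) ucrit p0 uleft.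
exists (m%:Z - (4 * r).+1%:Z), ((5 * r).+1%:Z) => k hk.
rewrite -vj -[in LHS](fK Pv) /coord.
have -> // : f (g v) k = w0 (k + (m%:Z - (4 * r).+1%:Z)).
apply: lf => // [|l lr]; first exact: gX.
apply: (@ord_inj b.+1); rewrite -/(digits _ _) -/(digits ray _) ray_digits.
have [q qE] : exists q : nat, (4 * r).+1%:Z + q%:Z = k + l.
  by exists (absz (k + l - (4 * r).+1%:Z)%R); lia.
rewrite -qE um (_ : _ + l = (m + q)%N%:Z) //; lia.
Qed.

Lemma other_coordinate_singleton : exists z, Y j = [set z].
Proof.
(* The zero sequence is a fixed point of the shift, so its image is constant. *)
pose zero : config 'I_b.+1 := of_digits b (fun=> 0%N).
have Xzero : X zero.
  by move=> k q _; rewrite of_digitsK.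
pose z0 := coord j (f zero).
have z0c k l : z0 k = z0 l.
  by rewrite /z0 /coord (lf (a := k) (y := zero) (b := l)).
have Yz0 : Y j z0 by exact: fP.
have [c0 [K0 h0]] := periodic_right_tail Yz0 (ltn0Sn 0) (fun k => z0c _ k).
have per z p : Y j z -> (0 < p)%N -> (forall k : int, z (k + p%:Z) = z k) ->
    z = z0.
  move=> Yz p0 zper; have [c [K h]] := periodic_right_tail Yz p0 zper.
  apply: funext => k; pose q := (`|k| + `|K| + `|K0| + `|c| + `|c0|)%N.
  rewrite -(translate_periodic q zper) h; last by nia.
  rewrite (z0c k (k + (q * p)%N%:Z + c - c0)) h0 ?subrK //; nia.
exists z0; apply/seteqP; split=> [y Yy|_ ->] //=.
apply: funext => k; pose w := update j w0 y.
have Pw : P w by exact: update_product.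
have [x Xx [xw [p p0 xper]]] := X_periodic (`|k| + r) (gX Pw).
have <- : coord j (f x) = z0.
  apply: (per _ p) => //; first exact: fP.
  move=> l; rewrite /coord (lf (a := l + p%:Z) (y := x) (b := l)) //.
  by move=> s _; rewrite addrAC xper.
rewrite -[y](coord_update w0 y) -/w -{1}(fK Pw) /coord.
rewrite (lf (a := k) (x := x) (y := g w) (b := k)) //; first exact: gX.
by move=> l lr; apply: xw; lia.
Qed.

End OtherCoordinate.

Lemma conjugate_critical_coordinate :
  (forall x, X x -> f (shift x) = shift (f x)) ->
  exists i, conjugate X (Y i) /\ forall j, j != i -> exists z, Y j = [set z].
Proof.
move=> fs; have [i i_crit] := critical_coordinate.
have single j : j != i -> exists z, Y j = [set z].
  by rewrite eq_sym => ij; exact: other_coordinate_singleton ij i_crit.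
exists i; split=> //.
have updE w : P w -> update i w0 (coord i w) = w.
  move=> Pw; apply: coord_ext => j; have [ij|ij] := eqVneq i j.
    by case: j / ij; rewrite coord_update.
  rewrite coord_update_neq //.
  have [|z Yz] := single j; first by rewrite eq_sym.
  have : Y j (coord j w0) by exact: Pw0.
  have : Y j (coord j w) by exact: Pw.
  by rewrite Yz /= => -> ->.
have Pupd y : Y i y -> P (update i w0 y) by exact: update_product.
exists (fun x => coord i (f x)), (fun y => g (update i w0 y)); split.
- by move=> x Xx; split; [exact: fP|rewrite updE ?gK //; exact: fP].
- move=> y Yy; split; first exact/gX/Pupd.
  by rewrite fK ?coord_update //; exact: Pupd.
- apply/within_continuous_configP => x Xx k; exists (`|k| + r)%N => y Xy yx.
  rewrite /coord (lf (x := y) (a := k) (y := x) (b := k)) // => l lr.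
  by apply: yx; lia.
- apply/within_continuous_configP => x Yx k; exists (`|k| + r)%N => y Yy yx.
  apply: lg; [exact: Pupd|exact: Pupd|move=> l lr].
  apply/ffunP => s; rewrite -/(coord s (update i w0 y) (k + l)).
  rewrite -/(coord s (update i w0 x) (k + l)).
  have [es|es] := eqVneq i s; last by rewrite !coord_update_neq.
  by case: s / es; rewrite !coord_update; apply: yx; lia.
- by move=> x Xx; rewrite fs.
Qed.

End Factorization.

Theorem theorem5p1 (R : realType) (beta : R) (hbeta : 1 < beta)
    (hsofic : ~ sofic (beta_shift beta)) :
  direct_prime (beta_shift beta).
Proof.
move=> n B Y subY [f [g [fP gX fc gc fs]]].
have d_aper := not_sofic_aperiodic hbeta hsofic.
have [_ clX shX] := beta_shift_subshift hbeta.
have cX : compact (beta_shift beta).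
  exact: subclosed_compact clX (@compact_config _) _.
have iX := subshift_invariant shX.
have iY i : shift_invariant (Y i) by have [_ _ /subshift_invariant] := subY i.
have iP : shift_invariant (product_shift Y).
  by move=> a w Pw i; exact: (iY i a _ (Pw i)).
have cP : compact (product_shift Y).
  have -> : product_shift Y = f @` beta_shift beta.
    apply/seteqP; split=> [y Py|_ [x Xx <-]]; last by case: (fP x Xx).
    by have [Xg fg] := gX y Py; exists (g y).
  exact: continuous_compact.
have gs y : product_shift Y y -> g (shift y) = shift (g y).
  move=> Py; have [Xg fg] := gX y Py.
  have [_ <-] : product_shift Y (f (shift (g y))) /\
      g (f (shift (g y))) = shift (g y) by exact: fP _ (iX 1 _ Xg).
  by rewrite fs // fg.
have [r1 lf] := local_rule_of_continuous cX iX fc fs.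
have [r2 lg] := local_rule_of_continuous cP iP gc gs.
have {}lf := local_rule_leq (leq_addr r2 r1) lf.
have {}lg := local_rule_leq (leq_addl r1 r2) lg.
have XE := beta_shiftE hbeta d_aper.
have perX := @periodic_approximation _ _ hbeta.
rewrite XE in fP gX fs lf lg perX *.
apply: (conjugate_critical_coordinate
  (beta_digit_self_admissible hbeta) (beta_digit0_gt0 hbeta)
  (fun i => beta_digit_le i hbeta) d_aper perX iY _ _ _ _ lf lg fs).
- by move=> x /fP[].
- by move=> y /gX[].
- by move=> y /gX[].
- by move=> x /fP[].
Qed.
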